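(* Let $n$ be a nonnegative integer, and let $q$, $C$ be indeterminates (with $q^C$ treated as an indeterminate). For an indeterminate $X$ and a positive integer $m$ let $B_m(X)$ denote the $n\times m$ matrix whose entry in row $r$ and column $k$ ($0\le r\le n-1$, $0\le k\le m-1$) is $[C+r]_q^{\,k}\,X^{r}$. Equivalently, each next column arises from the previous one by applying the operator $X^{1-C}D_qX^{C}$, where $D_qf(X)=(f(qX)-f(X))/((q-1)X)$. Given a composition $n=m_1+\dots+m_\ell$ of $n$ into positive integers and indeterminates $X_1,\dots,X_\ell$, there holds $$\det_{1\le i,j\le n}\big(B_{m_1}(X_1)\,B_{m_2}(X_2)\cdots B_{m_\ell}(X_\ell)\big)=q^{N_2}\Big(\prod_{i=1}^{\ell}X_i^{\binom{m_i}{2}}\prod_{j=1}^{m_i-1}[j]_q!\Big)\prod_{1\le i<j\le\ell}\ \prod_{s=0}^{m_i-1}\prod_{t=0}^{m_j-1}\big(q^{t-s}X_j-X_i\big),$$ where the matrix on the left is the $n\times n$ matrix obtained by placing the blocks side by side, and $$N_2=\sum_{i=1}^{\ell}\sum_{j=1}^{m_i}(C+j+m_1+\dots+m_{i-1}-1)(m_i-j)-\sum_{1\le i<j\le\ell}\Big(m_i\binom{m_j}{2}-m_j\binom{m_i}{2}\Big).$$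
   Context: $[\alpha]_q=(1-q^\alpha)/(1-q)$, $[j]_q!=[j]_q[j-1]_q\cdots[1]_q$, $[0]_q!=1$. Empty products equal $1$. *)

(* Defs.v *)
From mathcomp Require Export all_boot all_order all_algebra.
From mathcomp Require Export fraction.
From mathcomp Require Export mpoly.
From mathcomp Require Import ring.

Set Implicit Arguments.
Unset Strict Implicit.
Unset Printing Implicit Defensive.

Import GRing.Theory.
Local Open Scope ring_scope.

(* The exponents of q are affine forms a C + b in the symbol C with integer
   coefficients a and b; such a form is represented by the pair (a, b), and
   pairs are added componentwise. *)
Definition expo : zmodType := (int * int)%type.

Definition expC : expo := (1, 0).
Definition expZ (z : int) : expo := (0, z).

Section QCalculus.

Variable F : fieldType.
(* qC stands for q^C and is independent of q. *)
Variables q qC : F.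

Definition qpow (e : expo) : F := qC ^ e.1 * q ^ e.2.

Definition qnum (e : expo) : F := (1 - qpow e) / (1 - q).

Definition qfact (j : nat) : F := \prod_(1 <= i < j.+1) qnum (expZ i%:Z).

Definition Bmx (n m : nat) (x : F) : 'M[F]_(n, m) :=
  \matrix_(r < n, k < m) (qnum (expC + expZ (r : nat)%:Z) ^+ k * x ^+ r).

(* sigma is the substitution x |-> q x. *)
Definition Dq (sigma : F -> F) (x f : F) : F := (sigma f - f) / ((q - 1) * x).

(* With y standing for x^C, so that sigma y = q^C y, each column of Bmx is the
   image of the previous one under x^(1 - C) Dq x^C. *)
Lemma Bmx_next_col (sigma : {rmorphism F -> F}) (x y : F) (n m : nat)
    (r : 'I_n) (k k' : 'I_m) :
    q != 1 -> x != 0 -> y != 0 ->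
    sigma q = q -> sigma qC = qC -> sigma x = q * x -> sigma y = qC * y ->
    k' = k.+1 :> nat ->
  Bmx n m x r k' = x / y * Dq sigma x (y * Bmx n m x r k).
Proof.
move=> q1 x0 y0 sq sqC sx sy kk'; rewrite !mxE kk' /Dq.
have sqn : sigma (qnum (expC + expZ (r : nat)%:Z)) =
           qnum (expC + expZ (r : nat)%:Z).
  by rewrite /qnum /qpow /= fmorph_div !rmorphB !rmorph1 rmorphM !addr0 !add0r
             /= -!exprnP !rmorphXn /= sq sqC.
rewrite !rmorphM !rmorphXn /= sqn sx sy (exprMn r q x) exprS.
set a := qnum _ ^+ k.
have -> : qnum (expC + expZ (r : nat)%:Z) = (1 - qC * q ^+ r) / (1 - q).
  by rewrite /qnum /qpow /= addr0 add0r expr1z -exprnP.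
by field; rewrite x0 y0 !subr_eq0 q1 eq_sym q1.
Qed.

End QCalculus.

(* The l + 2 indeterminates q, q^C, X_1, ..., X_l over the coefficient domain
   R, as elements of the field of rational functions in them; the index i of
   X_i starts from 0. *)
Section Indeterminates.

Variables (R : idomainType) (l : nat).

Definition ratfun : fieldType := {fraction {mpoly R[2 + l]}}.

Definition indet (i : 'I_(2 + l)) : ratfun := tofrac ('X_i : {mpoly R[2 + l]}).

Definition qvar : ratfun := indet (lshift l ord0).
Definition qCvar : ratfun := indet (lshift l ord_max).
Definition Xvar (i : 'I_l) : ratfun := indet (rshift 2 i).

End Indeterminates.

Arguments Xvar R {l} i.

Definition N2 (l : nat) (m : 'I_l -> nat) : expo :=
  (\sum_(i < l) \sum_(1 <= j < (m i).+1)
     (expC + expZ (j%:Z + (\sum_(k < l | (k < i)%N) m k)%:Z - 1)) *+ (m i - j))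
  - expZ (\sum_(i < l) \sum_(j < l | (i < j)%N)
            ((m i * 'C(m j, 2))%:Z - (m j * 'C(m i, 2))%:Z)).

(* Main.v *)
(* [C + r]_q ^ k is a polynomial of degree k in q^r, with leading coefficient
   (q^C / (q - 1))^k.  Triangular column operations within each block therefore
   turn the matrix into a Vandermonde matrix at the points X_i q^k; its
   determinant splits into the pairs of points within one block, which give the
   q-factorials, and the pairs of points in two different blocks. *)

Require Import Defs.
From mathcomp Require Import ring zify.
Import GRing.Theory.
Local Open Scope ring_scope.

Lemma ltn_Rank (l : nat) (m : 'I_l -> nat) (i j : 'I_l)
    (s : 'I_(m i)) (t : 'I_(m j)) :
  (tagnat.Rank i s < tagnat.Rank j t)%N =
  (i < j)%N || (i == j) && (s < t)%N.
Proof.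
have -> : (tagnat.Rank i s < tagnat.Rank j t)%N =
    (tagnat.Rank i s < tagnat.Rank j t)%O by rewrite ltEord.
rewrite tagnat.lt_rank ltEsig /= !leEord ltEord.
case: (ltngtP i j) => [ltij|ltji|/val_inj eqij] /=.
- by [].
- by rewrite -val_eqE /= (gtn_eqF ltji).
- by case: _ / eqij t => t; rewrite eqxx tagged_asE.
Qed.

(* The indices of the concatenation are ordered lexicographically, so a pair
   s < t lies either within one block or in two blocks i < j. *)
Lemma prod_ltn_blocks (K : comPzRingType) (l : nat) (m : 'I_l -> nat)
    (f : 'I_l -> nat -> 'I_l -> nat -> K) :
  \prod_(s < \sum_(i < l) m i) \prod_(t < \sum_(i < l) m i | (s < t)%N)
    f (tagnat.sig1 s) (tagnat.sig2 s) (tagnat.sig1 t) (tagnat.sig2 t) =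
  (\prod_(i < l) \prod_(s < m i) \prod_(t < m i | (s < t)%N) f i s i t) *
  \prod_(i < l) \prod_(j < l | (i < j)%N) \prod_(s < m i) \prod_(t < m j)
    f i s j t.
Proof.
rewrite (reindex (@tagnat.rank _ m)) /=; last exact/onW_bij/tagnat.rank_bij.
transitivity (\prod_(i < l) \prod_(s < m i) \prod_(j < l)
    \prod_(t < m j | (i < j)%N || (i == j) && (s < t)%N) f i s j t).
  rewrite [RHS]sig_big_dep; apply: eq_bigr => -[i s] _ /=.
  rewrite [RHS]sig_big_dep (reindex (@tagnat.rank _ m)) /=; last first.
    exact/onW_bij/tagnat.rank_bij.
  apply: eq_big => [[j t] /=|[j t] _ /=]; first exact: ltn_Rank.
  by rewrite /tagnat.sig1 /tagnat.sig2 !tagnat.rankK.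
rewrite -big_split /=; apply: eq_bigr => i _.
rewrite [X in _ * X]exchange_big /= -big_split /=; apply: eq_bigr => s _.
(* The term [j = i] is the product over pairs within block [i]; for the other [j] the condition no
   longer involves [s < t]. *)
rewrite (bigD1 i) //= ltnn eqxx /=; congr (_ * _).
rewrite [LHS]big_mkcond [RHS]big_mkcond /=; apply: eq_bigr => j _.
rewrite [j == i]eq_sym; case: eqP => [<-|neqij] /=; first by rewrite ltnn.
by case: ltnP => //= _; rewrite big_pred0.
Qed.

Lemma is_trig_mxdiag (V : nmodType) (l : nat) (m : 'I_l -> nat)
    (B : forall i, 'M[V]_(m i)) :
  (forall i, is_trig_mx (B i)) -> is_trig_mx (\mxdiag_i B i).
Proof.
move=> trigB; apply/is_trig_mxblockP; split=> [i j ltij|i].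
  by rewrite -val_eqE (ltn_eqF ltij).
by rewrite eqxx conform_mx_id.
Qed.

Lemma det_mxdiag_trig (K : comPzRingType) (l : nat) (m : 'I_l -> nat)
    (B : forall i, 'M[K]_(m i)) :
  (forall i, is_trig_mx (B i)) ->
  \det (\mxdiag_i B i) = \prod_i \prod_k B i k k.
Proof.
move=> trigB; rewrite det_trig; last exact: is_trig_mxdiag.
rewrite [RHS]sig_big_dep [RHS](reindex _ tagnat.sig_bij_on) /=.
by apply: eq_bigr => s _; rewrite mxE eqxx conform_mx_id.
Qed.

Lemma sum_bin (k m : nat) : (\sum_(i < m) 'C(i, k) = 'C(m, k.+1))%N.
Proof.
by elim: m => [|m IHm]; rewrite ?big_ord0 // big_ord_recr /= IHm binS.
Qed.

(** Counts the 3-subsets of {1, ..., m} by their middle element [j]. *)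
Lemma sum_predM_subn (m : nat) :
  (\sum_(1 <= j < m.+1) j.-1 * (m - j) = 'C(m, 3))%N.
Proof.
rewrite big_add1 /= big_mkord; elim: m => [|m IHm]; first by rewrite big_ord0.
rewrite big_ord_recr /= subnn muln0 addn0 binS -IHm.
rewrite -bin2_sum big_mkord -big_split /=; apply: eq_bigr => i _.
by have := ltn_ord i; nia.
Qed.

Lemma sum_subn (m : nat) : (\sum_(1 <= j < m.+1) (m - j) = 'C(m, 2))%N.
Proof.
rewrite big_nat_rev /= big_add1 /= -bin2_sum big_mkord big_mkord.
by apply: eq_bigr => i _; have := ltn_ord i; lia.
Qed.

(** The offsets m_1 + ... + m_(i-1) contribute the sum of m_i C(m_j, 2) over i < j, which the
    subtracted part of [N2] cancels. Both components are thus natural numbers, in the form in which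
    the Vandermonde product yields them. *)
Lemma N2E (l : nat) (m : 'I_l -> nat) :
  N2 m = ((\sum_(i < l) 'C(m i, 2))%N%:Z,
          (\sum_(i < l) 'C(m i, 3) +
           \sum_(i < l) \sum_(j < l | (i < j)%N) m j * 'C(m i, 2))%N%:Z).
Proof.
have fstN2 : (N2 m).1 = (\sum_(i < l) 'C(m i, 2))%N%:Z.
  rewrite /N2 raddfB /= subr0 raddf_sum -[RHS]natz natr_sum.
  apply: eq_bigr => i _; rewrite raddf_sum -sum_subn natr_sum.
  by apply: eq_bigr => j _; rewrite raddfMn /= addr0.
have sndN2 : (N2 m).2 = (\sum_(i < l) 'C(m i, 3) +
    \sum_(i < l) \sum_(j < l | (i < j)%N) m j * 'C(m i, 2))%N%:Z.
  rewrite /N2 raddfB /= raddf_sum; apply/eqP; rewrite subr_eq; apply/eqP.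
  transitivity ((\sum_(i < l) ('C(m i, 3) +
      (\sum_(k < l | (k < i)%N) m k) * 'C(m i, 2)))%N%:Z).
    rewrite -[RHS]natz natr_sum; apply: eq_bigr => i _.
    rewrite raddf_sum -sum_predM_subn -sum_subn big_distrr -big_split natr_sum.
    rewrite !big_add1 /=; apply: eq_bigr => j _; rewrite raddfMn /= add0r.
    by rewrite -mulnDl natrM mulr_natr natz intS PoszD; congr (_ *+ _); lia.
  rewrite big_split /= !PoszD -addrA; congr (_ + _).
  under [X in _ = _ + X]eq_bigr do rewrite sumrB.
  rewrite sumrB.
  have sumZ (f : 'I_l -> 'I_l -> nat) :
      (\sum_(i < l) \sum_(j < l | (i < j)%N) f i j)%N%:Z =
      \sum_(i < l) \sum_(j < l | (i < j)%N) (f i j)%:Z.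
    rewrite -[LHS]natz natr_sum; apply: eq_bigr => i _; rewrite natr_sum.
    by apply: eq_bigr => j _; rewrite natz.
  rewrite -!sumZ addrC subrK; congr (Posz _).
  rewrite (exchange_big_dep xpredT) //=; apply: eq_bigr => i _.
  by rewrite big_distrl.
by rewrite -fstN2 -sndN2; case: (N2 m).
Qed.

Section BlockDeterminant.

Variables (F : fieldType) (q qC : F).
Hypotheses (q_neq0 : q != 0) (q_neq1 : q != 1).

Lemma qnum_expZ (j : nat) : qnum q qC (expZ j%:Z) = (1 - q ^+ j) / (1 - q).
Proof. by rewrite /qnum /qpow /= expr0z mul1r -exprnP. Qed.

(* The coefficients of [C + r]_q ^ k as a polynomial in q^r. *)
Definition qnum_coef (m : nat) : 'M[F]_m :=
  \matrix_(j < m, k < m) ((- qC) ^+ j / (1 - q) ^+ k *+ 'C(k, j)).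

(** Binomial expansion of (1 - q^C q^r)^k: its coefficients do not depend on r, and (q^r)^j x^r = (x
    q^j)^r. *)
Lemma Bmx_factor (n m : nat) (x : F) :
  Bmx q qC n m x =
  (\matrix_(r < n, k < m) (x * q ^+ k) ^+ r) *m qnum_coef m.
Proof.
apply/matrixP=> r k; rewrite !mxE.
have -> : qnum q qC (expC + expZ (r : nat)%:Z) =
    (1 + - qC * q ^+ r) / (1 - q).
  by rewrite /qnum /qpow /= addr0 add0r expr1z -exprnP mulNr.
rewrite expr_div_n exprDn !mulr_suml.
(* The sum over j <= k is widened to j < m; the entries of [qnum_coef] with j > k vanish because
   C(k, j) = 0. *)
rewrite (big_ord_widen m (fun j => 1 ^+ (k - j) *
   (- qC * q ^+ r) ^+ j *+ 'C(k, j) / (1 - q) ^+ k * x ^+ r)) //.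
rewrite big_mkcond /=; apply: eq_bigr => j _; rewrite !mxE ltnS.
case: leqP => [_|ltkj]; last by rewrite bin_small // mulr0n mulr0.
rewrite expr1n mul1r !exprMn -!exprM [(j * r)%N]mulnC.
rewrite !mulrnAl mulrnAr; congr (_ *+ _).
by move: (_ ^+ j) (_ ^+ k)^-1 => a b; ring.
Qed.

Lemma det_qnum_coef_diag (l : nat) (m : 'I_l -> nat) :
  \det (\mxdiag_(i < l) qnum_coef (m i)) =
  \prod_(i < l) \prod_(k < m i) (qC / (q - 1)) ^+ k.
Proof.
(* [qnum_coef] is upper triangular, while [is_trig_mx] means lower triangular. *)
rewrite -det_tr tr_mxdiag det_mxdiag_trig => [|i].
  apply: eq_bigr => i _; apply: eq_bigr => k _; rewrite !mxE binn mulr1n.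
  by rewrite -exprVn -exprMn -[q - 1]opprB invrN mulrN mulNr.
by apply/is_trig_mxP => j k ltjk; rewrite !mxE bin_small.
Qed.

(** Each factor equals x q^s (q - 1) [t - s]_q; reversing s turns the q-numbers into a
    q-factorial. *)
Lemma qfact_geometric (x : F) (t : nat) :
  \prod_(s < t) (x * q ^+ t - x * q ^+ s) =
  x ^+ t * q ^+ 'C(t, 2) * (q - 1) ^+ t * qfact q qC t.
Proof.
have q1 : 1 - q != 0 by rewrite subr_eq0 eq_sym.
rewrite -bin2_sum big_mkord expr_sum /qfact big_add1 /= big_mkord.
rewrite [X in _ = _ * X](reindex_inj rev_ord_inj) /=.
rewrite -[X in x ^+ X](card_ord t) -[X in (q - 1) ^+ X](card_ord t).
rewrite -!prodr_const -!big_split /=; apply: eq_bigr => s _.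
rewrite subnSK ?ltn_ord // qnum_expZ -{1}(subnKC (ltnW (ltn_ord s))) exprD.
by field.
Qed.

(** With the larger index t outermost, the powers (q - 1)^t cancel against the diagonal of the
    triangular factor, and the exponents t and C(t, 2) sum to C(m, 2) and C(m, 3). *)
Lemma block_Vandermonde (x : F) (m : nat) :
  (\prod_(s < m) \prod_(t < m | (s < t)%N) (x * q ^+ t - x * q ^+ s)) *
  \prod_(k < m) (qC / (q - 1)) ^+ k =
  qC ^+ 'C(m, 2) * q ^+ 'C(m, 3) *
  (x ^+ 'C(m, 2) * \prod_(1 <= j < m) qfact q qC j).
Proof.
rewrite (exchange_big_dep xpredT) //=.
rewrite -big_split /=.
(* The added factor at j = 0 is [0]_q! = 1. *)
have -> : \prod_(1 <= j < m) qfact q qC j = \prod_(j < m) qfact q qC j.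
  case: m => [|m]; first by rewrite big_geq // big_ord0.
  rewrite -(big_mkord xpredT (qfact q qC)) [RHS]big_ltn //.
  by rewrite [X in X * _](_ : _ = 1) ?mul1r // /qfact big_geq.
rewrite -[in RHS]bin2_sum big_mkord -sum_bin !expr_sum -!big_split /=.
apply: eq_bigr => t _.
rewrite (big_ord_narrow (ltnW (ltn_ord t))) /= qfact_geometric.
have q1 : q - 1 != 0 by rewrite subr_eq0.
by rewrite expr_div_n; field; rewrite expf_neq0.
Qed.

(** Each factor releases q^s, once for each of the [p] values of t. *)
Lemma cross_Vandermonde (x y : F) (m p : nat) :
  \prod_(s < m) \prod_(t < p) (y * q ^+ t - x * q ^+ s) =
  q ^+ (p * 'C(m, 2)) *
  \prod_(0 <= s < m) \prod_(0 <= t < p) (q ^ (t%:Z - s%:Z) * y - x).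
Proof.
rewrite mulnC exprM -bin2_sum !big_mkord expr_sum -prodrXl -big_split /=.
apply: eq_bigr => s _; rewrite big_mkord -[X in _ = _ ^+ X * _]card_ord.
rewrite -prodr_const -big_split /=; apply: eq_bigr => t _.
have -> : q ^+ t = q ^+ s * q ^ (t%:Z - s%:Z).
  by rewrite !exprnP -expfzDr // addrC subrK.
by ring.
Qed.

Lemma det_Bmx_row (l : nat) (m : 'I_l -> nat) (X : 'I_l -> F) :
  \det (\mxrow_(i < l) Bmx q qC (\sum_(i < l) m i) (m i) (X i)) =
  qpow q qC (N2 m)
  * (\prod_(i < l) (X i ^+ 'C(m i, 2)
       * \prod_(1 <= j < m i) qfact q qC j))
  * \prod_(i < l) \prod_(j < l | (i < j)%N)
      \prod_(0 <= s < m i) \prod_(0 <= t < m j)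
        (q ^ (t%:Z - s%:Z) * X j - X i).
Proof.
under eq_mxrow do rewrite Bmx_factor.
rewrite -mul_mxrow_mxdiag det_mulmx det_qnum_coef_diag.
pose a : 'rV[F]_(\sum_(i < l) m i) :=
  \row_s (X (tagnat.sig1 s) * q ^+ tagnat.sig2 s).
have -> : \mxrow_i (\matrix_(r < \sum_(i < l) m i, k < m i)
    (X i * q ^+ k) ^+ r) = Vandermonde (\sum_(i < l) m i) a.
  by apply/matrixP => r s; rewrite !mxE.
rewrite det_Vandermonde.
under eq_bigr => s _ do under eq_bigr => t _ do rewrite !mxE.
rewrite (prod_ltn_blocks _ _ _ (fun i s j t => X j * q ^+ t - X i * q ^+ s)).
(* The diagonal of the triangular factor is grouped with the pairs within blocks, ready for
   [block_Vandermonde]. *)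
rewrite mulrAC -big_split /=.
under eq_bigr do rewrite block_Vandermonde.
under [X in _ * X]eq_bigr => i _ do
  under eq_bigr => j _ do rewrite cross_Vandermonde.
rewrite N2E /qpow /= -!exprnP exprD !expr_sum.
under [\prod_(i < l) q ^+ (\sum_(j < l | (i < j)%N) _)]eq_bigr do
  rewrite expr_sum.
under [X in _ * X = _]eq_bigr do rewrite big_split /=.
rewrite !big_split /=; ring.
Qed.

End BlockDeterminant.

Theorem theorem24 (R : idomainType) (l : nat) (m : 'I_l -> nat)
    (m_gt0 : forall i : 'I_l, (0 < m i)%N) :
  \det (\mxrow_(i < l)
          Bmx (qvar R l) (qCvar R l) (\sum_(i < l) m i) (m i) (Xvar R i)) =
  qpow (qvar R l) (qCvar R l) (N2 m)
  * (\prod_(i < l) (Xvar R i ^+ 'C(m i, 2)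
       * \prod_(1 <= j < m i) qfact (qvar R l) (qCvar R l) j))
  * \prod_(i < l) \prod_(j < l | (i < j)%N)
      \prod_(0 <= s < m i) \prod_(0 <= t < m j)
        (qvar R l ^ (t%:Z - s%:Z) * Xvar R j - Xvar R i).
Proof.
apply: det_Bmx_row.
  (* Evaluating all indeterminates at 1 separates q from 0; evaluating them at 0 separates q from
     1. *)
  rewrite tofrac_eq0; apply/eqP => /(congr1 (mpoly.meval (fun=> 1))).
  by rewrite mpoly.mevalXU mpoly.meval0; apply/eqP/oner_neq0.
rewrite -tofrac1 tofrac_eq; apply/eqP => /(congr1 (mpoly.meval (fun=> 0))).
by rewrite mpoly.mevalXU mpoly.meval1 => /eqP; rewrite eq_sym oner_eq0.
Qed.
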